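(* Let $T=(T_1,\dots,T_d)$ be a contractive tuple on $H$ with $0<\Delta_T<\infty$. Then the sequence $\{\Delta_{T^n}: n=1,2,\dots\}$ is increasing in $n$ (i.e. $\Delta_{T^n}\le\Delta_{T^{n+1}}$ for all $n\ge 1$), and $\Delta_{T^n}\le(1+d+\cdots+d^{n-1})\,\Delta_T$ for each positive integer $n$.
   Context: Fix a positive integer $d$ and a complex, separable, infinite dimensional Hilbert space $H$. A $d$-tuple $T=(T_1,\dots,T_d)$ of bounded operators on $H$ (not assumed to commute) is contractive if $T_1T_1^*+\cdots+T_dT_d^*\le I$. Put $P_T(X)=\sum_{i=1}^d T_iXT_i^*$ for $X\in\mathcal B(H)$, and let $P_T^n$ be the $n$-fold iterate of $P_T$. For $n\ge1$, $T^n$ denotes the $d^n$-tuple of all products $T_{i_1}T_{i_2}\cdots T_{i_n}$, $1\le i_1,\dots,i_n\le d$ (so $P_{T^n}(I)=P_T^n(I)$). The $n$-th defect space is $H_n=\overline{\mathrm{Range}}\,(I-P_T^n(I))$ and the $n$-th defect dimension is $\Delta_{T^n}=\dim H_n$; in particular $\Delta_T=\dim H_1$. *)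

(* Defs.v *)
From mathcomp Require Import all_boot all_order all_algebra.
From mathcomp Require Import sesquilinear complex.
From mathcomp Require Import all_classical all_reals all_analysis.

Set Implicit Arguments.
Unset Strict Implicit.
Unset Printing Implicit Defensive.

Import Order.TTheory GRing.Theory Num.Theory.
Import numFieldNormedType.Exports.

Local Open Scope classical_set_scope.
Local Open Scope ring_scope.

Definition separable (X : topologicalType) : Prop :=
  exists2 D : set X, countable D & dense D.

Definition linear_span (K : numFieldType) (V : lmodType K) (B : set V) : set V :=
  [set x | exists (s : seq V) (c : V -> K),
     [set` s] `<=` B /\ x = \sum_(v <- s) c v *: v].

Section Hilbert.
Variables (R : realType) (H : completeNormedModType R[i]).
Variable ip : {dot H for (@Num.conj R[i])}.

(* The given norm of H is the one of the inner product, so that H, which is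
   complete for its norm, is a Hilbert space. *)
Definition hilbert_norm : Prop := forall x : H, `|x| ^+ 2 = ip x x.

Definition orthonormal_set (B : set H) : Prop :=
  forall u v, B u -> B v -> ip u v = (u == v)%:R.

(* Orthonormal basis of the closed subspace M, in the Hilbert space sense. *)
Definition orthonormal_basis (M B : set H) : Prop :=
  orthonormal_set B /\ closure (linear_span B) = M.

(* The dimension of the closed subspace M: the number of elements, possibly
   +oo, of an orthonormal basis of M.  One always exists, and all of them have
   the same cardinality, so that the choice made by [get] is irrelevant. *)
Definition hilbert_dim (M : set H) : \bar R :=
  counting (get [set B | orthonormal_basis M B]).

Definition bounded_operator (A : H -> H) : Prop :=
  exists M : R[i], forall x, `|A x| <= M * `|x|.

(* The unique operator satisfying the adjunction identity; it exists as soon as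
   A is linear and bounded, by the Riesz representation theorem. *)
Definition adjoint (A : H -> H) : H -> H :=
  get [set S : H -> H | forall x y, ip (A x) y = ip x (S y)].

(* Loewner order.  An inequality in R[i] forces the difference of its two sides
   to be a nonnegative real. *)
Definition operator_le (A B : H -> H) : Prop :=
  forall x, 0 <= ip (B x - A x) x.

Section Tuple.
Variables (d : nat) (T : 'I_d -> {linear H -> H}).

Definition cp_map (X : H -> H) : H -> H :=
  fun x => \sum_(i < d) T i (X (adjoint (T i) x)).

Definition contractive : Prop := operator_le (cp_map id) id.

Definition defect_space (n : nat) : set H :=
  closure (range (fun x => x - iter n cp_map id x)).

Definition defect_dim (n : nat) : \bar R := hilbert_dim (defect_space n).

End Tuple.

End Hilbert.

(* Main.v *)
From HB Require Import structures.
Require Import Defs.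
From mathcomp Require Import all_boot all_order all_algebra.
From mathcomp Require Import finmap sesquilinear complex.
From mathcomp Require Import all_classical all_reals all_analysis.
From mathcomp Require Import ring.
Import Order.TTheory GRing.Theory Num.Theory.
Import numFieldNormedType.Exports.
Local Open Scope classical_set_scope.
Local Open Scope ring_scope.

(** Write P for the map X |-> sum_i T_i X T_i^* and D_n = I - P^n(I) for the
    n-th defect operator, so that the n-th defect space is the closure of the
    range of D_n.

    Monotonicity.  D_(n+1) - D_n = P^n(I) - P^(n+1)(I) is the image of the
    positive operator I - P(I) under the positive map P^n, hence
    0 <= D_n <= D_(n+1) ([defect_increment_ge0], [defect_ge0]).  If p is
    orthogonal to the range of D_(n+1), then <D_(n+1) p, p> = 0, so
    <D_n p, p> = 0, and D_n p = 0 because a vector on which a positive form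
    vanishes lies in the kernel of its operator ([positive_form_kernel]).  By
    symmetry the range of D_n is orthogonal to p, which yields
    range D_n <= range D_(n+1) as soon as the latter is finite-dimensional
    ([range_defect_subset]).

    Bound.  D_(n+1) = D_1 + P(D_n) ([defect_recursion]), and the range of
    P(D_n) is spanned by the images of the range of D_n under the d operators
    T_i.  If D_1 has rank r and D_n has rank at most m, then D_(n+1) has rank
    at most r + d m ([spanned_defect_succ]); iterating gives
    (1 + d + ... + d^(n-1)) r.

    Two facts make these arguments available.  The adjoints satisfy the
    adjunction identity, by the Riesz representation theorem
    ([riesz_representation], [adjointP]), proved here by minimizing an energy
    over the whole space.  And every defect space is finite-dimensional: the
    bound above confines all ranges to spans of finite families, such spans of
    orthonormal families are closed ([spanned_closed]), and their Hilbert
    dimension is the size of the family ([hilbert_dim_spanned]). *)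

(** * The Cauchy-Schwarz inequality *)

Section InnerProduct.
Set Implicit Arguments.
Unset Strict Implicit.
Variables (R : realType) (H : completeNormedModType R[i]).
Variable ip : {dot H for (@Num.conj R[i])}.
Implicit Types x y z : H.

Lemma ipC x y : ip x y = (ip y x)^*.
Proof. by rewrite hermC expr0 mul1r. Qed.

Lemma ip_eq0 x : (forall y, ip y x = 0) -> x = 0.
Proof. by move=> /(_ x)/eqP; rewrite dnorm_eq0 => /eqP. Qed.

Hypothesis H_norm : hilbert_norm ip.

Lemma cauchy_schwarz x y : `|ip x y| <= `|x| * `|y|.
Proof.
rewrite -(@ler_pXn2r _ 2) ?nnegrE ?mulr_ge0// exprMn !H_norm.
have [->|y0] := eqVneq y 0; first by rewrite !linear0r normr0 expr0n.
have yy : 0 < ip y y by rewrite dnorm_gt0.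
have ryy : (ip y y)^* = ip y y by rewrite -ipC.
set a := ip x y / ip y y.
have := dnorm_ge0 ip (x - a *: y).
suff -> : ip (x - a *: y) (x - a *: y) = ip x x - `|ip x y| ^+ 2 / ip y y.
  by rewrite subr_ge0 ler_pdivrMr.
rewrite dnormB dnormZ linearZr_LR/= !normCK /a !(rmorphM, fmorphV)/=.
rewrite conjCK !ryy.
by field; rewrite gt_eqF.
Qed.

End InnerProduct.

(** * The Riesz representation theorem *)

Section Riesz.
Set Implicit Arguments.
Unset Strict Implicit.
Variables (R : realType) (H : completeNormedModType R[i]).
Variable ip : {dot H for (@Num.conj R[i])}.
Hypothesis H_norm : hilbert_norm ip.
Variables (f : H -> R[i]) (M : R[i]).
Hypothesis f_linear : scalar f.
Hypothesis f_bounded : forall x, `|f x| <= M * `|x|.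
Implicit Types x y z : H.

(** The real functional |x|^2 - 2 Re f(x) = |x - z|^2 - |z|^2, for z the
    representing vector of f: its unique minimizer is that vector. *)
Let energy x : R[i] := ip x x - (f x + (f x)^*).

Let fD x y : f (x + y) = f x + f y.
Proof. by have := f_linear 1 x y; rewrite scale1r mul1r. Qed.

Let f0 : f 0 = 0.
Proof. by apply: (@addrI _ (f 0)); rewrite -fD !addr0. Qed.

Let fZ a x : f (a *: x) = a * f x.
Proof. by have := f_linear a x 0; rewrite addr0 f0 addr0. Qed.

Let energy_real x : energy x \is Num.real.
Proof.
apply: rpredB; first by rewrite ger0_real.
by rewrite CrealE rmorphD/= conjCK addrC.
Qed.

Let energy_Re x : (complex.Re (energy x))%:C%C = energy x.
Proof. exact/RRe_real/energy_real. Qed.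

Let energy_ge x : - `|M| ^+ 2 <= energy x.
Proof.
have fM : `|f x| <= `|M| * `|x|.
  have := f_bounded x; have [->|x0] := eqVneq `|x| 0; first by rewrite !mulr0.
  move=> h; have := h; rewrite -(ger0_norm (le_trans _ h))// normrM normr_id.
  by [].
have h : f x + (f x)^* <= 2 * (`|M| * `|x|).
  have r : f x + (f x)^* \is Num.real by rewrite CrealE rmorphD/= conjCK addrC.
  apply: le_trans (real_ler_norm r) _; apply: le_trans (ler_normD _ _) _.
  by rewrite norm_conjC mulr2n mulrDl mul1r lerD.
rewrite /energy -H_norm lerBrDl.
rewrite lerBlDr; apply: le_trans h _; rewrite -subr_ge0.
suff -> : `|x| ^+ 2 + `|M| ^+ 2 - 2 * (`|M| * `|x|) = (`|x| - `|M|) ^+ 2.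
  by rewrite real_exprn_even_ge0// realB// normr_real.
by ring.
Qed.

(** The infimum exists in the reals; it is carried back to the complex numbers
    because all later estimates take place in the order of the latter. *)
Let energy_inf : exists2 m : R[i], (forall x, m <= energy x) &
  forall e, 0 < e -> exists x, energy x < m + e.
Proof.
pose E := range (fun x => complex.Re (energy x)).
have lbE : has_lbound E.
  exists (complex.Re (- `|M| ^+ 2)) => _ [x _ <-].
  by have := energy_ge x; rewrite lecE => /andP[].
have infE : has_inf E by split=> //; exists (complex.Re (energy 0)); exists 0.
exists (inf E)%:C%C => [x|e e0].
  by rewrite -energy_Re lecR; apply: ge_inf => //; exists x.
have eE : (complex.Re e)%:C%C = e by rewrite RRe_real// gtr0_real.
have e'0 : 0 < complex.Re e by rewrite -ltcR eE.
have [_ [x _ <-]] := inf_adherent e'0 infE.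
by exists x; rewrite -energy_Re -eE -rmorphD/= ltcR.
Qed.

(** By the parallelogram law, two points whose energies are close to the
    infimum are close to each other, their midpoint having no smaller energy
    than the infimum. *)
Let energy_parallelogram x y :
  `|x - y| ^+ 2 = 2 * (energy x + energy y) - 4 * energy (2^-1 *: (x + y)).
Proof.
rewrite H_norm dnormB /energy fZ dnormZ dnormD fD !(rmorphM, rmorphD)/=.
rewrite fmorphV rmorph_nat ger0_norm ?invr_ge0//.
by field.
Qed.

(** Variation of the energy in the direction h, with the phase of the
    increment chosen so that the first-order term is a negative multiple of
    |<h, x> - f h|^2. *)
Let energy_perturb x h s : s \is Num.real ->
  energy (x + (- (s * (ip h x - f h)^*)) *: h) =
  energy x - (2 * s - s ^+ 2 * ip h h) * `|ip h x - f h| ^+ 2.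
Proof.
move=> /conj_Creal sE.
rewrite /energy dnormD fD fZ dnormZ linearZr_LR/= (ipC ip x h) !normCK.
rewrite !(rmorphM, rmorphD, rmorphN)/= !conjCK sE.
by ring.
Qed.

(** The sublevel sets of the energy above its infimum form a Cauchy filter, by
    [energy_parallelogram]; its limit z represents f.  Indeed, at a point x of
    nearly minimal energy, the decrease of energy given by [energy_perturb] is
    small, so <h, x> - f h is small, and <h, x> is close to <h, z>. *)
Lemma riesz_representation : exists z, forall x, f x = ip x z.
Proof.
have [m m_le m_lt] := energy_inf.
pose F := filter_from [set e : R | 0 < e]
  (fun e => [set x | energy x < m + e%:C%C]).
have FF : ProperFilter F.
  apply: filter_from_proper; last first.
    by move=> e e0; apply: m_lt; rewrite ltcR.
  apply: filter_from_filter; first by exists 1 => /=.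
  move=> e1 e2 e10 e20; exists (Num.min e1 e2); first by rewrite /= lt_min e10.
  move=> x /= /lt_le_trans h; split; apply: h.
    by rewrite lerD2l lecR ge_min lexx.
  by rewrite lerD2l lecR ge_min lexx orbT.
have F_near e : 0 < e -> F [set x | energy x < m + e].
  move=> e0; have eE : (complex.Re e)%:C%C = e by rewrite RRe_real// gtr0_real.
  by exists (complex.Re e) => /=; rewrite ?eE// -ltcR eE.
have cF : cvg F.
  apply/cauchy_cvgP/cauchy_exP => e e0.
  (* Within e^2 / 4 of the infimum, the parallelogram law bounds the squared
     distance by 2 (e^2 / 4 + e^2 / 4) = e^2. *)
  have e40 : 0 < e ^+ 2 / 4 by rewrite divr_gt0 ?exprn_gt0.
  have [x xm] := m_lt _ e40; exists x.
  apply: filterS (F_near _ e40) => y /= ym.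
  rewrite -ball_normE /= -(@ltr_pXn2r _ 2) ?nnegrE ?(ltW e0)//.
  rewrite energy_parallelogram ltrBlDr.
  have -> : e ^+ 2 + 4 * energy (2^-1 *: (x + y)) =
    2 * ((energy (2^-1 *: (x + y)) + e ^+ 2 / 4) +
         (energy (2^-1 *: (x + y)) + e ^+ 2 / 4)).
    by field.
  rewrite ltr_pM2l// ltrD//; [apply: lt_le_trans xm _|apply: lt_le_trans ym _].
    by rewrite lerD2r.
  by rewrite lerD2r.
pose z := lim F; exists z => h; apply/eqP.
rewrite eq_sym -subr_eq0 -normr_le0; apply/ler_addgt0Pr => e e0; rewrite add0r.
have h0 : 0 < ip h h + 1 by rewrite ltr_wpDl.
(* This step size makes the decrease of energy equal to
   (s + s^2) |<h, x> - f h|^2. *)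
pose s := (ip h h + 1)^-1.
have s0 : 0 < s by rewrite invr_gt0.
have e20 : 0 < e / 2 by rewrite divr_gt0.
have d0 : 0 < (e / 2) ^+ 2 * s by rewrite mulr_gt0 ?exprn_gt0.
have h'0 : 0 < `|h| + 1 by rewrite ltr_wpDl.
have : nbhs z (ball z ((e / 2) / (`|h| + 1)))
  by apply: nbhsx_ballx; rewrite divr_gt0.
move=> /(cF _) /filterI /(_ (F_near _ d0)) /filter_ex[x /=].
rewrite -ball_normE /= => -[zx xm].
have -> : ip h z - f h = ip h (z - x) + (ip h x - f h).
  by rewrite linearBr; ring.
rewrite (le_trans (ler_normD _ _))// [leRHS]splitr lerD//.
  apply: le_trans (cauchy_schwarz H_norm _ _) _.
  apply: (@le_trans _ _ ((`|h| + 1) * `|z - x|)).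
    by rewrite ler_wpM2r// lerDl.
  by rewrite mulrC -ler_pdivlMr// ltW.
rewrite -(@ler_pXn2r _ 2) ?nnegrE ?(ltW e20)//.
have cE : 2 * s - s ^+ 2 * ip h h = s + s ^+ 2.
  by rewrite /s; field; rewrite gt_eqF.
have := m_le (x + (- (s * (ip h x - f h)^*)) *: h).
rewrite energy_perturb ?gtr0_real// cE lerBrDr => h1.
have := le_lt_trans h1 xm; rewrite ltrD2l => h2.
rewrite -(@ler_pM2r _ s)//; apply: le_trans (ltW h2).
by rewrite mulrDl [leLHS]mulrC lerDl mulr_ge0// exprn_ge0// ltW.
Qed.

End Riesz.
(** * Spans of finite orthonormal families and the Hilbert dimension *)

Section OrthonormalFamilies.
Set Implicit Arguments.
Unset Strict Implicit.
Variables (R : realType) (H : completeNormedModType R[i]).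
Variable ip : {dot H for (@Num.conj R[i])}.
Hypothesis H_norm : hilbert_norm ip.
Implicit Types x y z : H.

(** Families indexed by finite types, rather than sets or sequences of vectors,
    keep track of cardinality through sums and products of index types, with
    repetitions allowed. *)
Definition spanned (I : finType) (g : I -> H) : set H :=
  [set x | exists c : I -> R[i], x = \sum_i c i *: g i].

Definition orthonormal_family (I : finType) (g : I -> H) : Prop :=
  forall i j, ip (g i) (g j) = (i == j)%:R.

Definition residual (I : finType) (g : I -> H) x : H :=
  x - \sum_i ip x (g i) *: g i.

Lemma spanned_gen (I : finType) (g : I -> H) i : spanned g (g i).
Proof.
exists (fun j => (j == i)%:R); rewrite (bigD1 i)//= eqxx scale1r big1 ?addr0//.
by move=> j /negPf->; rewrite scale0r.
Qed.

Lemma spanned0 (I : finType) (g : I -> H) : spanned g 0.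
Proof. by exists (fun=> 0); rewrite big1// => i _; rewrite scale0r. Qed.

Lemma spanned_linear (I : finType) (g : I -> H) (a : R[i]) x y :
  spanned g x -> spanned g y -> spanned g (a *: x + y).
Proof.
move=> [c ->] [c' ->]; exists (fun i => a * c i + c' i).
rewrite scaler_sumr -big_split; apply: eq_bigr => i _ /=.
by rewrite scalerDl scalerA.
Qed.

Lemma spanned_sum (I : finType) (g : I -> H) (V : eqType) (s : seq V)
    (c : V -> R[i]) (f : V -> H) :
  (forall v, v \in s -> spanned g (f v)) ->
  spanned g (\sum_(v <- s) c v *: f v).
Proof.
elim: s => [|v s IH] gf; first by rewrite big_nil; exact: spanned0.
rewrite big_cons; apply: spanned_linear; first exact/gf/mem_head.
by apply: IH => w ws; apply: gf; rewrite inE ws orbT.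
Qed.

(** With g = C f, the Gram matrix of g is the product of C with the matrix of
    the <f_i, g_k>; it is the identity, so its size is at most the inner
    dimension. *)
Lemma orthonormal_card_le (I J : finType) (f : I -> H) (g : J -> H) :
  orthonormal_family g -> (forall j, spanned f (g j)) -> (#|J| <= #|I|)%N.
Proof.
move=> og /choice[c gE].
pose A := \matrix_(j < #|J|, i < #|I|) c (enum_val j) (enum_val i).
pose B := \matrix_(i < #|I|, j < #|J|) ip (f (enum_val i)) (g (enum_val j)).
apply: (@mulmx1_min _ _ _ A B); apply/matrixP => j k; rewrite !mxE.
under eq_bigr do rewrite !mxE.
rewrite -(inj_eq enum_val_inj) -og [in RHS]gE linear_sumlz.
rewrite [RHS](big_enum_val (A := I)).
by apply: eq_bigr => i _; rewrite linearZl_LR.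
Qed.

Lemma ip_residual (I : finType) (g : I -> H) x y :
  orthonormal_family g -> spanned g y -> ip (residual g x) y = 0.
Proof.
move=> og [c ->]; rewrite linear_sumr big1// => i _.
rewrite linearZr_LR/= linearBl linear_sumlz (bigD1 i)//= linearZl_LR/= og eqxx.
rewrite mulr1 big1 ?addr0 ?subrr ?mulr0// => j /negPf ji.
by rewrite linearZl_LR/= og ji mulr0.
Qed.

Lemma residual0_spanned (I : finType) (g : I -> H) x :
  residual g x = 0 -> spanned g x.
Proof. by move/subr0_eq => xE; exists (fun i => ip x (g i)). Qed.

Lemma ip_residual_self (I : finType) (g : I -> H) x :
  orthonormal_family g ->
  ip x (residual g x) = ip (residual g x) (residual g x).
Proof.
move=> og; rewrite {3}/residual linearBl/= [X in _ - X]ipC.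
rewrite ip_residual ?rmorph0 ?subr0//.
by exists (fun i => ip x (g i)).
Qed.

Lemma spanned_expansion (I : finType) (g : I -> H) x :
  orthonormal_family g -> spanned g x -> x = \sum_i ip x (g i) *: g i.
Proof.
move=> og gx; apply/eqP; rewrite -subr_eq0 -(dnorm_eq0 ip).
rewrite -[X in ip X X]/(residual g x) -ip_residual_self// ipC.
by rewrite ip_residual ?rmorph0.
Qed.

(** If x is adherent to the span and p is its residual, then, for y in the span
    at distance less than |p| of x,
    |p|^2 = <p, x> = <p, x - y> <= |p| |x - y|, so p = 0. *)
Lemma spanned_closed (I : finType) (g : I -> H) :
  orthonormal_family g -> closure (spanned g) = spanned g.
Proof.
move=> og; apply/seteqP; split; last exact: subset_closure.
move=> x cx; apply: residual0_spanned; set p := residual g x.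
apply/eqP/contraT; rewrite -normr_gt0 => p0.
have [y [gy]] := cx _ (nbhsx_ballx x `|p| p0).
rewrite -ball_normE/= -(ltr_pM2l p0) => xy.
suff : `|p| * `|p| <= `|p| * `|x - y|.
  by move/le_lt_trans => /(_ _ xy); rewrite ltxx.
have -> : `|p| * `|p| = `|ip p (x - y)|.
  rewrite linearBr /= (ip_residual x og gy) subr0 ipC norm_conjC.
  by rewrite ip_residual_self// -H_norm ger0_norm ?exprn_ge0// expr2.
exact: cauchy_schwarz.
Qed.

Lemma linear_span_spanned (I : finType) (g : I -> H) :
  orthonormal_family g -> linear_span (range g) = spanned g.
Proof.
move=> og; apply/seteqP; split=> x.
  move=> [s [c [sg ->]]]; apply: spanned_sum => v /sg[i _ <-].
  exact: spanned_gen.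
move=> gx; exists (map g (index_enum I)), (fun v => ip x v); split.
  by move=> _ /= /mapP[i _ ->]; exists i.
by rewrite big_map; exact: spanned_expansion.
Qed.

Lemma orthonormal_basis_range (I : finType) (g : I -> H) :
  orthonormal_family g -> orthonormal_basis ip (spanned g) (range g).
Proof.
move=> og; split; last by rewrite linear_span_spanned// spanned_closed.
move=> _ _ [i _ <-] [j _ <-]; rewrite og (inj_eq (f := g))// => {}i {}j gij.
have := og i j; rewrite -gij og eqxx => /eqP.
by rewrite eqr_nat; case: (eqVneq i j).
Qed.

Lemma orthonormal_set_family (B : set H) (X : {fset H}) :
  orthonormal_set ip B -> [set` X] `<=` B ->
  orthonormal_family (fun v : X => val v).
Proof. by move=> oB XB u v; rewrite oB//; apply: XB; exact: valP. Qed.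

Lemma finite_orthonormal_set_family (B : set H) :
  orthonormal_set ip B -> finite_set B ->
  let g := fun v : fset_set B => val v in
  orthonormal_family g /\ closure (linear_span B) = spanned g.
Proof.
move=> oB finB g.
have XB : [set` fset_set B] = B by rewrite fset_setK.
have og : orthonormal_family g.
  by apply: (orthonormal_set_family oB); rewrite XB.
split=> //; rewrite -[in RHS](spanned_closed og) -linear_span_spanned//.
congr (closure (linear_span _)); rewrite -{1}XB; apply/seteqP; split => x.
  by move=> /= xX; exists [` xX]%fset.
by move=> [v _ <-]; exact: valP.
Qed.

(** The dimension counts a chosen basis B, which may differ from g.  Comparing
    finite subsets of B with g shows that B is finite, and then B and g span
    the same space, so that each has at most as many elements as the other. *)
Lemma hilbert_dim_spanned (I : finType) (g : I -> H) :
  orthonormal_family g -> hilbert_dim ip (spanned g) = #|I|%:R%:E.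
Proof.
move=> og; rewrite /hilbert_dim; set B := get _.
have [oB clB] : orthonormal_basis ip (spanned g) B.
  by apply: getPex; exists (range g); exact: orthonormal_basis_range.
have Bg : B `<=` spanned g.
  rewrite -clB; apply: subset_trans (@subset_closure _ _) => v Bv.
  exists [:: v], (fun=> 1); split; last by rewrite big_seq1 scale1r.
  by move=> u /=; rewrite inE => /eqP ->.
have finB : finite_set B.
  apply: contrapT => /(infinite_set_fset #|I|.+1)[X XB].
  have := orthonormal_card_le (orthonormal_set_family oB XB) (f := g).
  rewrite -cardfE leqNgt => h hX; move: hX; apply/negP/h => v.
  by apply/Bg/XB; exact: valP.
have [oX] := finite_orthonormal_set_family oB finB.
rewrite clB /counting asboolT// cardfE => gE; congr (_%:R%:E).
apply/eqP; rewrite eqn_leq; apply/andP; split.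
  apply: (orthonormal_card_le oX (f := g)) => v.
  by rewrite gE; exact: spanned_gen.
apply: (orthonormal_card_le og (f := fun v : fset_set B => val v)) => i.
by rewrite -gE; exact: spanned_gen.
Qed.

(** Positivity of the dimension guarantees that M has an orthonormal basis at
    all: without one, the choice made in [hilbert_dim] would be the empty
    set. *)
Lemma finite_hilbert_dim (M : set H) :
  (0 < hilbert_dim ip M)%E -> (hilbert_dim ip M < +oo)%E ->
  exists (I : finType) (g : I -> H), orthonormal_family g /\ M = spanned g.
Proof.
rewrite /hilbert_dim.
have [exB|nexB] := pselect (exists B, orthonormal_basis ip M B).
  set B := get _; have [oB clB] : orthonormal_basis ip M B by exact: getPex.
  move=> _; rewrite /counting; case: asboolP; rewrite ?ltxx// => finB _.
  have [oX] := finite_orthonormal_set_family oB finB.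
  by rewrite clB; exists (fset_set B), (fun v => val v).
rewrite getPN => [|B MB]; last by apply: nexB; exists B.
by rewrite /counting asboolT ?fset_set0 ?ltxx//; exact: finite_set0.
Qed.

(** An orthonormal family in M of largest cardinality spans M: a nonzero
    residual, once normalized, would extend it. *)
Lemma orthonormal_family_of_subspace (M : set H) (I : finType) (f : I -> H) :
  M 0 -> (forall a x y, M x -> M y -> M (a *: x + y)) ->
  M `<=` spanned f ->
  exists (J : finType) (g : J -> H), orthonormal_family g /\ M = spanned g.
Proof.
move=> M0 MP Mf.
pose P k := `[< exists (J : finType) (g : J -> H),
  [/\ #|J| = k, orthonormal_family g & forall j, M (g j)] >].
have exP : exists k, P k.
  exists 0%N; apply/asboolP; exists void, (fun v : void => match v with end).
  by split=> [|[]|[]]; rewrite ?card_void.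
have leP k : P k -> (k <= #|I|)%N.
  move=> /asboolP[J [g [<- og Mg]]].
  by apply: (orthonormal_card_le og) => j; exact/Mf.
case: (ex_maxnP exP leP) => k /asboolP[J [g [Jk og Mg]]] kmax.
have gM : spanned g `<=` M.
  move=> _ [c ->]; elim: (index_enum J) => [|j s IH]; first by rewrite big_nil.
  by rewrite big_cons; exact: MP.
exists J, g; split=> //; apply/seteqP; split=> // x Mx.
apply: residual0_spanned; set p := residual g x; apply/eqP/contraT => p0.
have Mp : M p.
  rewrite /p /residual addrC -scaleN1r; apply: MP => //; apply: gM.
  by exists (fun j => ip x (g j)).
have np : `|p| != 0 by rewrite normr_eq0.
pose h (o : option J) := if o is Some j then g j else `|p|^-1 *: p.
have oh : orthonormal_family h.
  have ph j : ip p (g j) = 0 by apply: ip_residual => //; exact: spanned_gen.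
  move=> [i|] [j|] /=; first exact: og.
  - by rewrite linearZr_LR/= ipC ph rmorph0 mulr0.
  - by rewrite linearZl_LR/= ph mulr0.
  rewrite dnormZ -H_norm normfV normr_id -exprMn mulVf//.
  by rewrite expr1n.
suff /kmax : P #|J|.+1 by rewrite Jk ltnn.
apply/asboolP; exists (option J), h; split=> //; first by rewrite card_option.
move=> [j|] //=; rewrite -[_ *: _]addr0; exact: MP.
Qed.

End OrthonormalFamilies.
(** * Adjoints and positive operators *)

Section Adjoint.
Set Implicit Arguments.
Unset Strict Implicit.
Variables (R : realType) (H : completeNormedModType R[i]).
Variable ip : {dot H for (@Num.conj R[i])}.
Hypothesis H_norm : hilbert_norm ip.
Variable A : {linear H -> H}.
Hypothesis A_bounded : bounded_operator A.

Lemma adjointP x y : ip (A x) y = ip x (adjoint ip A y).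
Proof.
suff : exists S : H -> H, forall x y, ip (A x) y = ip x (S y).
  by move/getPex; exact.
suff /choice[S SP] : forall v, exists z, forall u, ip (A u) v = ip u z.
  by exists S => u v; exact: SP.
move=> v; case: A_bounded => M AM.
apply: (riesz_representation (f := fun u => ip (A u) v) (M := M * `|v|) H_norm).
  by move=> a u w /=; rewrite linearP linearDl linearZl_LR.
move=> u; apply: le_trans (cauchy_schwarz H_norm _ _) _.
by rewrite mulrAC ler_wpM2r.
Qed.

Lemma adjoint_linear a x y :
  adjoint ip A (a *: x + y) = a *: adjoint ip A x + adjoint ip A y.
Proof.
apply/subr0_eq/(ip_eq0 (ip := ip)) => u; rewrite linearBr/= -adjointP.
by rewrite !linearDr !linearZr_LR/= -!adjointP subrr.
Qed.

End Adjoint.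

Section PositiveOperator.
Set Implicit Arguments.
Unset Strict Implicit.
Variables (R : realType) (H : completeNormedModType R[i]).
Variable ip : {dot H for (@Num.conj R[i])}.
Variable A : {linear H -> H}.
Hypothesis A_sym : forall x y, ip (A x) y = ip x (A y).
Hypothesis A_ge0 : forall x, 0 <= ip (A x) x.

(** Otherwise <A y, y> would be negative at y = x - s A x for small s > 0, where
    it equals - 2 s |A x|^2 + s^2 <A A x, A x>. *)
Lemma positive_form_kernel x : ip (A x) x = 0 -> A x = 0.
Proof.
move=> Ax0; apply/eqP/contraT => Axn0.
pose a := ip (A x) (A x); pose b := ip (A (A x)) (A x).
have a0 : 0 < a by rewrite dnorm_gt0.
have b0 : 0 <= b by exact: A_ge0.
have b1 : 0 < b + 1 by rewrite ltr_wpDl.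
(* For this s, the value - 2 s a + s^2 b simplifies to - s (a + s). *)
pose s := a / (b + 1).
have s0 : 0 < s by rewrite divr_gt0.
have := A_ge0 (x + (- s) *: A x).
suff -> : ip (A (x + (- s) *: A x)) (x + (- s) *: A x) = - (s * (a + s)).
  by rewrite oppr_ge0 lt_geF//; apply: mulr_gt0 => //; apply: addr_gt0.
have sE : s^* = s by rewrite conj_Creal// gtr0_real.
rewrite linearD linearZ/= !(linearDl ip, linearDr ip)/=.
rewrite !(linearZl_LR ip, linearZr_LR ip)/=.
rewrite Ax0 [ip (A (A x)) x]A_sym rmorphN/= sE -/a -/b /s.
by field; rewrite gt_eqF.
Qed.

End PositiveOperator.

(** * Defect operators *)

Section Defect.
Set Implicit Arguments.
Unset Strict Implicit.
Variables (R : realType) (H : completeNormedModType R[i]).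
Variable ip : {dot H for (@Num.conj R[i])}.
Hypothesis H_norm : hilbert_norm ip.
Variables (d : nat) (T : 'I_d -> {linear H -> H}).
Hypothesis T_bounded : forall i, bounded_operator (T i).
Hypothesis T_contractive : contractive ip T.

Local Notation P := (cp_map ip T).

Definition defect n x := x - iter n P id x.

Lemma iter_cp_linear n : linear (iter n P id : H -> H).
Proof.
elim: n => [//|n IH] a x y /=; rewrite /cp_map scaler_sumr -big_split.
by apply: eq_bigr => i _ /=; rewrite adjoint_linear// IH linearP.
Qed.

Lemma defect_linear n : linear (defect n).
Proof.
move=> a x y; rewrite /defect iter_cp_linear scalerBr opprD addrACA.
by rewrite -!addrA.
Qed.

HB.instance Definition _ n :=
  GRing.isLinear.Build _ _ _ _ (defect n) (@defect_linear n).

Lemma iter_cp_sym n x y : ip (iter n P id x) y = ip x (iter n P id y).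
Proof.
elim: n x y => [//|n IH] x y /=; rewrite /cp_map linear_sumlz linear_sumr.
apply: eq_bigr => i _; rewrite /= (adjointP H_norm (T_bounded i)) IH.
by rewrite ipC -(adjointP H_norm (T_bounded i)) -ipC.
Qed.

Lemma defect_sym n x y : ip (defect n x) y = ip x (defect n y).
Proof. by rewrite /defect linearBl linearBr/= iter_cp_sym. Qed.

Lemma cp_mapB (X Y : H -> H) x :
  P X x - P Y x = P (fun u => X u - Y u) x.
Proof.
by rewrite /cp_map -sumrB; apply: eq_bigr => i _; rewrite linearB.
Qed.

Lemma cp_map_ge0 (X : H -> H) :
  (forall x, 0 <= ip (X x) x) -> forall x, 0 <= ip (P X x) x.
Proof.
move=> X0 x; rewrite /cp_map linear_sumlz; apply: sumr_ge0 => i _.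
by rewrite /= (adjointP H_norm (T_bounded i)).
Qed.

(** The increment is P^n(I) - P^(n+1)(I) = P^n(I - P(I)), and P preserves
    positivity. *)
Lemma defect_increment_ge0 n x : 0 <= ip (defect n.+1 x - defect n x) x.
Proof.
have -> : defect n.+1 x - defect n x = iter n P id x - iter n.+1 P id x.
  by rewrite /defect [X in X - _]addrC addrKA opprK addrC.
elim: n x => [|n IH] x; first exact: T_contractive.
by rewrite !iterS cp_mapB; exact: cp_map_ge0.
Qed.

Lemma defect_ge0 n x : 0 <= ip (defect n x) x.
Proof.
elim: n => [|n IH]; first by rewrite /defect subrr linear0l.
have := addr_ge0 (defect_increment_ge0 n x) IH.
by rewrite -linearDl subrK.
Qed.

Lemma defect_recursion n x : defect n.+1 x = defect 1 x + P (defect n) x.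
Proof.
have -> : P (defect n) x = P id x - iter n.+1 P id x by rewrite iterS cp_mapB.
by rewrite /defect addrA subrK.
Qed.

(** The residual p of D_n y is orthogonal to the range of D_(n+1), which forces
    D_n p = 0 by positivity; so |p|^2 = <D_n y, p> = <y, D_n p> = 0. *)
Lemma range_defect_subset (I : finType) (g : I -> H) n :
  orthonormal_family ip g -> range (defect n.+1) `<=` spanned g ->
  range (defect n) `<=` spanned g.
Proof.
move=> og Dg _ [y _ <-].
apply: (residual0_spanned (ip := ip)); set p := residual _ _ _.
have D1p : ip (defect n.+1 p) p = 0.
  rewrite defect_sym; by apply: ip_residual => //; apply: Dg; exists p.
have Dp0 : defect n p = 0.
  apply: (positive_form_kernel (ip := ip)).
  - exact: defect_sym.
  - exact: defect_ge0.
  apply/eqP; rewrite eq_le defect_ge0 andbT -oppr_ge0.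
  by have := defect_increment_ge0 n p; rewrite linearBl/= D1p sub0r.
apply/eqP; rewrite -(dnorm_eq0 ip) -ip_residual_self//.
by rewrite defect_sym Dp0 linear0r.
Qed.

(** The sum type indexes the r generators of the range of D_1 together with the
    d m vectors T_i g_j that generate the range of P(D_n). *)
Lemma spanned_defect_succ (I J : finType) (f : I -> H) (g : J -> H) n :
  range (defect 1) `<=` spanned f -> range (defect n) `<=` spanned g ->
  range (defect n.+1) `<=` spanned (fun k : I + 'I_d * J =>
    match k with inl i => f i | inr (i, j) => T i (g j) end).
Proof.
move=> D1f Dng _ [x _ <-]; rewrite defect_recursion.
have [c ->] : spanned f (defect 1 x) by apply: D1f; exists x.
have /choice[c' c'E] : forall i, spanned g (defect n (adjoint ip (T i) x)).
  by move=> i; apply: Dng; exists (adjoint ip (T i) x).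
exists (fun k => match k with inl i => c i | inr (i, j) => c' i j end).
rewrite big_sumType /=; congr (_ + _).
rewrite (eq_bigr (fun k => c' k.1 k.2 *: T k.1 (g k.2))); last by case.
rewrite -(pair_bigA _ (fun i j => c' i j *: T i (g j))) /=.
apply: eq_bigr => i _; rewrite c'E linear_sum.
by apply: eq_bigr => j _; rewrite linearZ.
Qed.

Lemma defect_space_spanned (I : finType) (f : I -> H) n :
  range (defect n) `<=` spanned f ->
  exists (J : finType) (g : J -> H),
    [/\ orthonormal_family ip g, range (defect n) = spanned g &
        defect_dim ip T n = #|J|%:R%:E].
Proof.
move=> Df.
have D0 : range (defect n) 0 by exists 0 => //; rewrite linear0.
have DP a x y : range (defect n) x -> range (defect n) y ->
    range (defect n) (a *: x + y).
  by move=> [u _ <-] [v _ <-]; exists (a *: u + v) => //; rewrite linearP.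
have [J [g [og gE]]] := orthonormal_family_of_subspace H_norm D0 DP Df.
exists J, g; split=> //.
rewrite /defect_dim /defect_space.
rewrite -[X in hilbert_dim _ (closure X)]/(range (defect n)).
by rewrite gE (spanned_closed H_norm og) hilbert_dim_spanned.
Qed.

End Defect.

(** * Defect dimensions of the powers of a contractive tuple *)

Theorem lemma2p1 (R : realType) (H : completeNormedModType R[i])
  (ip : {dot H for (@Num.conj R[i])})
  (H_norm : hilbert_norm ip)
  (H_separable : separable H)
  (H_infinite_dim : hilbert_dim ip [set: H] = +oo%E)
  (d : nat) (d_gt0 : (0 < d)%N)
  (T : 'I_d -> {linear H -> H})
  (T_bounded : forall i, bounded_operator (T i))
  (T_contractive : contractive ip T)
  (defect_gt0 : (0 < defect_dim ip T 1)%E)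
  (defect_fin : (defect_dim ip T 1 < +oo)%E) :
  (forall n, (0 < n)%N -> (defect_dim ip T n <= defect_dim ip T n.+1)%E) /\
  (forall n, (0 < n)%N ->
     (defect_dim ip T n <=
        (\sum_(k < n) d ^ k)%N%:R%:E * defect_dim ip T 1)%E).
Proof.
have [I [f [of1 fE]]] := finite_hilbert_dim H_norm defect_gt0 defect_fin.
have Df : range (defect ip T 1) `<=` spanned f.
  by rewrite -fE; exact: subset_closure.
have dim1 : defect_dim ip T 1 = #|I|%:R%:E.
  by rewrite /defect_dim fE hilbert_dim_spanned.
have Dg n : (0 < n)%N -> exists (J : finType) (g : J -> H),
    (#|J| <= (\sum_(k < n) d ^ k) * #|I|)%N /\
    range (defect ip T n) `<=` spanned g.
  elim: n => // -[_ _|n /(_ isT)[J [g [Jle Dng]]] _].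
    by exists I, f; rewrite big_ord1 mul1n.
  exists (I + 'I_d * J)%type, (fun k : I + 'I_d * J =>
    match k with inl i => f i | inr (i, j) => T i (g j) end).
  split; last exact: spanned_defect_succ.
  rewrite card_sum card_prod card_ord big_ord_recl expn0 mulnDl mul1n leq_add2l.
  under eq_bigr do rewrite lift0 expnS.
  by rewrite -big_distrr/= -mulnA leq_mul2l Jle orbT.
split=> n n0.
  have [J [g [_ Dng]]] := Dg n n0.
  have [K [h [oh hE ->]]] := defect_space_spanned H_norm T_bounded Dng.
  have [J' [g' [_ Dng']]] := Dg n.+1 isT.
  have [K' [h' [oh' h'E ->]]] := defect_space_spanned H_norm T_bounded Dng'.
  rewrite lee_fin ler_nat; apply: (orthonormal_card_le oh (f := h')) => k.
  have Dn_sub : range (defect ip T n) `<=` spanned h'.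
    apply: (range_defect_subset H_norm T_bounded T_contractive oh').
    by rewrite h'E.
  by apply: Dn_sub; rewrite hE; exact: spanned_gen.
have [J [g [Jle Dng]]] := Dg n n0.
have [K [h [oh hE ->]]] := defect_space_spanned H_norm T_bounded Dng.
rewrite dim1 -EFinM lee_fin -natrM ler_nat; apply: leq_trans Jle.
apply: (orthonormal_card_le oh) => k; apply: Dng; rewrite hE.
exact: spanned_gen.
Qed.
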